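(* Let $n\ge2$, let $P=(P_1,\ldots,P_n)$ be a positive regular polynomial $n$-tuple and let $m\in\mathbb N^n$. The multiplication $n$-tuple $\mathscr M_z=(\mathscr M_{z_1},\ldots,\mathscr M_{z_n})$ defines a commuting $n$-tuple (of bounded linear operators) on $\mathscr H^2_m(\triangle^n_P)$. Moreover, $$\|\mathscr M_{z_j}\|\le\frac1{\sqrt{\prod_{l=j}^n\partial_lP_l(0)}},\qquad j=1,\ldots,n.$$
   Context: $\mathbb N$ = positive integers, $\mathbb C_*=\mathbb C\setminus\{0\}$, $z\diamond w=(z_1w_1,\ldots,z_nw_n)$, and $\overline z$ is the entrywise conjugate. For $n\ge2$ let $\varphi(z)=\big(\frac{z_1}{z_2},\ldots,\frac{z_{n-1}}{z_n},z_n\big)$ for $z\in\mathbb C\times\mathbb C_*^{n-1}$. A polynomial $n$-tuple $P=(P_1,\ldots,P_n)$ in $\mathbb C[z_1,\ldots,z_n]$ is positive regular if for each $j$, $P_j$ has nonnegative coefficients and $P_j(z)=a_jz_j+\sum_{k=2}^{N_j}Q_{jk}(z)$ with $a_j>0$ and $Q_{jk}$ homogeneous of degree $k$. The $P$-triangle is $\triangle^n_P=\{z\in\mathbb C\times\mathbb C_*^{n-1}: P_j(\varphi(z)\diamond\overline{\varphi(z)})<1,\ j=1,\ldots,n\}$. For $m\in\mathbb N^n$, $\mathscr H^2_m(\triangle^n_P)$ is the reproducing kernel Hilbert space of holomorphic functions on $\triangle^n_P$ with the positive semi-definite kernel $$\mathscr K_{P,m}(z,w)=\prod_{j=2}^n\frac1{z_j\overline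 w_j}\prod_{j=1}^n\frac1{\big(1-P_j(\varphi(z)\diamond\overline{\varphi(w)})\big)^{m_j}},\qquad z,w\in\triangle^n_P.$$ $\mathscr M_{z_j}$ is the linear operator of multiplication by the coordinate function: $\mathscr M_{z_j}f=z_jf$ whenever $f,\ z_jf\in\mathscr H^2_m(\triangle^n_P)$. $\partial_l$ is the partial derivative in $z_l$. *)

(* Defs.v *)
From HB Require Import structures.
From mathcomp Require Import all_boot all_order all_algebra sesquilinear.
From mathcomp Require Import all_classical all_reals all_analysis.
From mathcomp Require Export complex.
From mathcomp Require mpoly.
(* The notations of mpoly clash with those of the analysis library, while its
   canonical instances are only active once it is imported. *)
Export -(notations) mpoly.
Export Order.TTheory GRing.Theory Num.Theory numFieldNormedType.Exports.

Set Implicit Arguments.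
Unset Strict Implicit.
Unset Printing Implicit Defensive.

Local Open Scope classical_set_scope.
Local Open Scope ring_scope.

Section Triangle.
Variables (R : realType) (n : nat).
Local Notation C := R[i].

(* [0 < x] and [0 <= x] in [C] entail that [x] is real. *)
Definition positive_regular (P : 'I_n -> mpoly n C) :=
  forall j : 'I_n,
    (forall u : multinom n, 0 <= mcoeff u (P j)) /\
    exists (a : C) (N : nat) (Q : nat -> mpoly n C),
      [/\ 0 < a,
          forall k, Q k \is ishomog1 k (mpoly.Measure.clone n mdeg _) &
          P j = a *: mpolyX C (mnm1 j) + \sum_(2 <= k < N.+1) Q k].

(* Coordinates are numbered from 0; [insub j.+1] is [None] exactly when [j] is
   the last index. *)
Definition phi (z : 'rV[C]_n) : 'rV[C]_n :=
  \row_j (if insub j.+1 is Some k then z 0 j / z 0 k else z 0 j).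

Definition diamond (z w : 'rV[C]_n) : 'rV[C]_n := \row_j (z 0 j * w 0 j).

Definition conjv (z : 'rV[C]_n) : 'rV[C]_n := map_mx Num.conj z.

Definition peval (p : mpoly n C) (z : 'rV[C]_n) : C := meval (fun i => z 0 i) p.

Definition triangle (P : 'I_n -> mpoly n C) : set 'rV[C]_n :=
  [set z : 'rV[C]_n | (forall j : 'I_n, (0 < j)%N -> z 0 j != 0) /\
           (forall j, peval (P j) (diamond (phi z) (conjv (phi z))) < 1)].

Definition triangle_kernel (P : 'I_n -> mpoly n C) (m : 'I_n -> nat)
    (z w : triangle P) : C :=
  (\prod_(j < n | (0 < j)%N) (1 / (val z 0 j * (val w 0 j)^*))) *
  \prod_(j < n)
    (1 / (1 - peval (P j) (diamond (phi (val z)) (conjv (phi (val w))))) ^+ m j).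

(* Functions on [D] live on the subtype of [D]; for open [D], [f] is holomorphic
   iff some ambient extension of it is complex differentiable on [D]. *)
Definition holomorphic (D : set 'rV[C]_n) (f : D -> C) :=
  exists g : 'rV[C]_n -> C^o,
    (forall z : D, f z = g (val z)) /\
    (forall z : ('rV[C]_n : normedModType C), D z -> differentiable g z).

End Triangle.

(* A Hilbert space of functions on [X] with reproducing kernel [K]. [rkhs_fun]
   identifies the vectors with functions; the inner product is linear in its
   first argument. Such a space is determined by [K] up to a unique isometric
   isomorphism commuting with [rkhs_fun]. *)
Record rkhs (R : realType) (X : Type) (K : X -> X -> R[i]) := Rkhs {
  rkhs_space :> completeNormedModType R[i] ;
  rkhs_dot : {dot rkhs_space for Num.conj} ;
  rkhs_normE : forall f : rkhs_space, `|f| ^+ 2 = rkhs_dot f f ;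
  rkhs_fun : {linear rkhs_space -> (X -> R[i]^o)} ;
  rkhs_fun_inj : injective rkhs_fun ;
  rkhs_ker : X -> rkhs_space ;
  rkhs_kerE : forall x w, rkhs_fun (rkhs_ker w) x = K x w ;
  rkhs_reproducing : forall f w, rkhs_fun f w = rkhs_dot f (rkhs_ker w) }.

Record hardy_triangle (R : realType) (n : nat) (P : 'I_n -> mpoly n R[i])
    (m : 'I_n -> nat) := HardyTriangle {
  hardy_rkhs :> rkhs (@triangle_kernel R n P m) ;
  hardy_holomorphic : forall f : hardy_rkhs, holomorphic (rkhs_fun _ f) }.

(* The graph of multiplication by [z_j], with its maximal domain: those [f] for
   which [z_j f] is again in the space. *)
Definition mulz_graph (R : realType) (n : nat) (P : 'I_n -> mpoly n R[i])
    (m : 'I_n -> nat) (H : hardy_triangle P m) (j : 'I_n) (f g : H) :=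
  forall z : triangle P, rkhs_fun H g z = val z 0 j * rkhs_fun H f z.

Definition bounded_operator (R : realType) (V : normedModType R[i])
    (T : V -> V) :=
  exists c : R, forall f : V, `|T f| <= (c%:C)%C * `|f|.

(* Norms take (real) values in [R[i]], whence the real part. [sup] is 0 on
   unbounded sets, so this is meaningful for bounded operators only. *)
Definition opnorm (R : realType) (V : normedModType R[i]) (T : V -> V) : R :=
  sup [set complex.Re `|T f| | f in [set f : V | `|f| <= 1]].

(* Main.v *)
(** Write [a_l] for the coefficient of [z_l] in [P_l], so that [a_l] is the
    partial derivative of [P_l] at the origin, [u_l] for the kernel
    [phi_l(z) conj(phi_l(w))], and [c] for the product of the [a_l] over [l >= j].
    Since [z_j] is the product of the [phi_l(z)] over [l >= j], the kernel
    [(1/c - z_j conj(w_j)) K(z, w)] is [1/c] times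
    [(1 - prod_(l >= j) a_l u_l) K(z, w)]. Now [1 - prod a_l u_l] telescopes, and
    [(1 - a_l u_l) / (1 - P_l(u)) = 1 + (P_l(u) - a_l u_l) / (1 - P_l(u))], where
    [P_l(u) - a_l u_l] has nonnegative coefficients. Expanding [1 / (1 - P_l(u))]
    in a geometric series exhibits everything as a limit of finite sums of kernels
    [f(z) conj(f(w))], hence as positive semi-definite.

    Positivity says that [k_w |-> conj(w_j) k_w] extends to an operator of norm at
    most [1/sqrt c] on combinations of kernel functions, and [M_j] is its adjoint. *)

Require Import Defs.
From HB Require Import structures.
From mathcomp Require Import all_boot all_order all_algebra sesquilinear.
From mathcomp Require Import all_classical all_reals all_analysis.
From mathcomp Require Import ring.

Set Implicit Arguments.
Unset Strict Implicit.
Unset Printing Implicit Defensive.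

Local Open Scope classical_set_scope.
Local Open Scope ring_scope.

(** * Limits of Gram kernels *)

(** The order on [K] may be partial, so the sign is read off the norm: [|u i| = u i] converges both
    to [|l|] and to [l]. *)
Lemma cvgn_ge0 (K : numFieldType) (u : nat -> K^o) (l : K^o) :
  u @ \oo --> l -> (forall i, (0 : K) <= u i) -> (0 : K) <= l.
Proof.
move=> ul u0; have nl := cvg_norm ul.
suff <- : `|l| = l by exact: normr_ge0.
have uE : (fun i => `|u i| : K^o) = u by apply/funext => i; exact: ger0_norm.
rewrite uE in nl; apply: (norm_cvg_unique _ ul).
exact: nl.
Qed.

Section Kernels.
Variables (R : realType) (X : Type).
Local Notation C := R[i].
Implicit Types k : X -> X -> C.

Definition finite_gram k :=
  exists s : seq (X -> C), forall z w, k z w = \sum_(f <- s) f z * (f w)^*.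

(** This form of positivity is chosen because products of finite Gram sums are finite Gram sums, so
    closure under products passes to the limit. *)
Definition gram_limit k :=
  exists2 kn : nat -> X -> X -> C, (forall i, finite_gram (kn i)) &
    forall z w, (kn i z w : C^o) @[i --> \oo] --> (k z w : C^o).

Lemma finite_gram1 (f : X -> C) : finite_gram (fun z w => f z * (f w)^*).
Proof. by exists [:: f] => z w; rewrite big_seq1. Qed.

Lemma finite_gramC (a : C) : 0 <= a -> finite_gram (fun _ _ => a).
Proof.
move=> a0; exists [:: fun _ => sqrtC a] => z w.
by rewrite big_seq1 conj_Creal ?ger0_real ?sqrtC_ge0// -expr2 sqrtCK.
Qed.

Lemma finite_gramD k1 k2 : finite_gram k1 -> finite_gram k2 ->
  finite_gram (fun z w => k1 z w + k2 z w).
Proof.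
by move=> [s1 e1] [s2 e2]; exists (s1 ++ s2) => z w; rewrite big_cat e1 e2.
Qed.

Lemma finite_gramM k1 k2 : finite_gram k1 -> finite_gram k2 ->
  finite_gram (fun z w => k1 z w * k2 z w).
Proof.
move=> [s1 e1] [s2 e2].
exists [seq (fun z => f z * g z) | f <- s1, g <- s2] => z w.
rewrite big_allpairs_dep /= e1 e2 mulr_suml; apply: eq_bigr => f _.
by rewrite mulr_sumr; apply: eq_bigr => g _; rewrite rmorphM mulrACA.
Qed.

Lemma finite_gram_sum (I : Type) (r : seq I) (k : I -> X -> X -> C) :
  (forall i, finite_gram (k i)) ->
  finite_gram (fun z w => \sum_(i <- r) k i z w).
Proof.
move=> gk; elim: r => [|i r [s e]].
  by exists [::] => z w; rewrite !big_nil.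
by have [t et] := gk i; exists (t ++ s) => z w; rewrite big_cons big_cat -e -et.
Qed.

Lemma finite_gramX k n : finite_gram k -> finite_gram (fun z w => k z w ^+ n).
Proof.
move=> gk; elim: n => [|n ih]; first exact: finite_gramC.
have [s e] := finite_gramM gk ih.
by exists s => z w; rewrite exprS e.
Qed.

(** Each summand obeys [|f z| |f w| <= (|f z|^2 + |f w|^2) / 2], since [(|f z| - |f w|)^2] is
    nonnegative. *)
Lemma finite_gram_norm_le k z w : finite_gram k ->
  `|k z w| <= (k z z + k w w) / 2.
Proof.
move=> [s e]; rewrite !e -big_split/= mulr_suml.
apply: (le_trans (ler_norm_sum _ _ _)); apply: ler_sum => f _.
rewrite normrM norm_conjC -!normCK ler_pdivlMr ?ltr0n// mulr_natr.
rewrite -subr_ge0.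
have -> : `|f z| ^+ 2 + `|f w| ^+ 2 - `|f z| * `|f w| *+ 2 =
  (`|f z| - `|f w|) ^+ 2 by rewrite sqrrB addrAC.
by rewrite real_exprn_even_ge0// rpredB.
Qed.

Lemma finite_gram_limit k : finite_gram k -> gram_limit k.
Proof. by move=> gk; exists (fun _ => k) => // z w; exact: cvg_cst. Qed.

Lemma gram_limitD k1 k2 : gram_limit k1 -> gram_limit k2 ->
  gram_limit (fun z w => k1 z w + k2 z w).
Proof.
move=> [u1 g1 c1] [u2 g2 c2]; exists (fun i z w => u1 i z w + u2 i z w).
  by move=> i; apply: finite_gramD.
by move=> z w; apply: cvgD; [exact: c1|exact: c2].
Qed.

Lemma gram_limitM k1 k2 : gram_limit k1 -> gram_limit k2 ->
  gram_limit (fun z w => k1 z w * k2 z w).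
Proof.
move=> [u1 g1 c1] [u2 g2 c2]; exists (fun i z w => u1 i z w * u2 i z w).
  by move=> i; apply: finite_gramM.
by move=> z w; apply: cvgM; [exact: c1|exact: c2].
Qed.

Lemma eq_gram_limit k1 k2 : (forall z w, k1 z w = k2 z w) ->
  gram_limit k1 -> gram_limit k2.
Proof.
by move=> e; have -> : k1 = k2 by apply/funext => z; apply/funext => w.
Qed.

Lemma gram_limitX k n : gram_limit k -> gram_limit (fun z w => k z w ^+ n).
Proof.
move=> gk; elim: n => [|n ih].
  exact/finite_gram_limit/finite_gramC.
by apply: eq_gram_limit (gram_limitM gk ih) => z w; rewrite exprS.
Qed.

Lemma gram_limit_prod (I : Type) (r : seq I) (p : pred I)
    (k : I -> X -> X -> C) :
  (forall i, gram_limit (k i)) ->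
  gram_limit (fun z w => \prod_(i <- r | p i) k i z w).
Proof.
move=> gk; elim: r => [|i r ih].
  apply: eq_gram_limit (finite_gram_limit (finite_gramC ler01)) => z w.
  by rewrite big_nil.
case pi : (p i); last first.
  by apply: eq_gram_limit ih => z w; rewrite big_cons pi.
by apply: eq_gram_limit (gram_limitM (gk i) ih) => z w; rewrite big_cons pi.
Qed.

Lemma cvg_expr_complex (x : C) : `|x| < 1 ->
  (x ^+ i : C^o) @[i --> \oo] --> (0 : C^o).
Proof.
have /complex_realP[r nr] := normr_real x; rewrite nr => x1.
have r0 : 0 <= r by rewrite -lecR -nr; exact: normr_ge0.
have r1 : `|r| < 1 by rewrite ger0_norm// -ltcR.
apply/cvgr0Pnorm_lt => e e0.
have /complex_realP[d ed] := gtr0_real e0.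
have d0 : 0 < d by rewrite -ltcR -ed.
have /cvgr0Pnorm_lt/(_ _ d0) := cvg_expr r1.
apply: filterS => i; rewrite ger0_norm ?exprn_ge0// -ltcR -ed rmorphXn/=.
by rewrite -nr normrX.
Qed.

(** Carries the bound off the diagonal, so that the geometric series in [k z w] converges at every
    pair of points. *)
Lemma finite_gram_norm_lt1 k z w : finite_gram k -> (forall x, k x x < 1) ->
  `|k z w| < 1.
Proof.
move=> gk k1; apply: (le_lt_trans (finite_gram_norm_le z w gk)).
by rewrite ltr_pdivrMr ?ltr0n// mul1r -[2]/(1 + 1) ltrD.
Qed.

Lemma gram_limit_inv1B k : finite_gram k -> (forall z, k z z < 1) ->
  gram_limit (fun z w => 1 / (1 - k z w)).
Proof.
move=> gk k1; exists (fun n z w => \sum_(0 <= i < n) k z w ^+ i).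
  by move=> n; apply: finite_gram_sum => i; apply: finite_gramX.
move=> z w.
have kzw := finite_gram_norm_lt1 z w gk k1.
have kN1 : k z w != 1 by apply/eqP => e; rewrite e normr1 ltxx in kzw.
have -> : (fun n => \sum_(0 <= i < n) k z w ^+ i) =
    (fun n => (1 - k z w ^+ n) / (1 - k z w)).
  apply/funext => n.
  have /= := congr1 (fun u => u n) (geometric_seriesE 1 kN1).
  rewrite mul1r => <-.
  by rewrite seriesEnat; apply: eq_bigr => i _; rewrite /= mul1r.
rewrite -[X in X / (1 - _)](subr0 1).
apply: cvgM; last exact: cvg_cst.
by apply: cvgB; [exact: cvg_cst|exact: cvg_expr_complex].
Qed.

Lemma gram_limit_psd k (s : seq (C * X)) : gram_limit k ->
  0 <= \sum_(p <- s) \sum_(q <- s) p.1 * (q.1)^* * k q.2 p.2.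
Proof.
move=> [u g c].
apply: (@cvgn_ge0 C
  (fun i => \sum_(p <- s) \sum_(q <- s) p.1 * (q.1)^* * u i q.2 p.2)).
  apply: (@cvg_big C^o) => [|p _]; first exact: add_continuous.
  apply: (@cvg_big C^o) => [|q _]; first exact: add_continuous.
  by apply: cvgM; [exact: cvg_cst|exact: c].
move=> i; have [t e] := g i.
under eq_bigr do under eq_bigr do rewrite e mulr_sumr.
under eq_bigr do rewrite exchange_big/=.
rewrite exchange_big/=; apply: sumr_ge0 => f _.
(* For each [f] the double sum is the squared modulus of a single sum. *)
have -> : \sum_(p <- s) \sum_(q <- s) p.1 * (q.1)^* * (f q.2 * (f p.2)^*) =
   (\sum_(p <- s) p.1 * (f p.2)^*) * (\sum_(p <- s) p.1 * (f p.2)^*)^*.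
  rewrite rmorph_sum mulr_suml; apply: eq_bigr => p _.
  rewrite mulr_sumr; apply: eq_bigr => q _.
  by rewrite rmorphM/= conjCK [f _ * _]mulrC mulrACA.
by rewrite -normCK exprn_ge0.
Qed.

(** One factor of the power is spent on [(1 - t) / (1 - k) = 1 + (k - t) / (1 - k)], whence [0 < m];
    the others are Gram limits by themselves. *)
Lemma gram_limit_1BM_inv1BX k t m : finite_gram t ->
  finite_gram (fun z w => k z w - t z w) -> (forall z, k z z < 1) -> (0 < m)%N ->
  gram_limit (fun z w => (1 - t z w) * (1 / (1 - k z w)) ^+ m).
Proof.
case: m => // m gt gkt k1 _.
have gk : finite_gram k.
  have [s e] := finite_gramD gt gkt.
  by exists s => z w; rewrite -e addrC subrK.
have gD := gram_limit_inv1B gk k1.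
apply: (eq_gram_limit _ (gram_limitM
  (gram_limitD (finite_gram_limit (finite_gramC ler01))
     (gram_limitM (finite_gram_limit gkt) gD)) (gram_limitX m gD))) => z w /=.
have kzw := finite_gram_norm_lt1 z w gk k1.
have kN1 : 1 - k z w != 0.
  by rewrite subr_eq0; apply/eqP => e; rewrite -e normr1 ltxx in kzw.
by rewrite exprS [RHS]mulrA; congr (_ * _); field.
Qed.

(** Induction on [1 - t T = (1 - t) + t (1 - T)], where [t] is the first factor and [T] the product
    of the rest. *)
Lemma gram_limit_1B_prod (I : Type) (r : seq I) (p : pred I)
    (t D : I -> X -> X -> C) :
  (forall i, gram_limit (t i)) -> (forall i, gram_limit (D i)) ->
  (forall i, gram_limit (fun z w => (1 - t i z w) * D i z w)) ->
  gram_limit (fun z w => (1 - \prod_(i <- r | p i) t i z w) *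
                         \prod_(i <- r | p i) D i z w).
Proof.
move=> gt gD gtD; elim: r => [|i r ih].
  apply: eq_gram_limit (finite_gram_limit (finite_gramC (lexx 0))) => z w.
  by rewrite big_nil subrr mul0r.
case pi : (p i); last by apply: eq_gram_limit ih => z w; rewrite !big_cons pi.
apply: (eq_gram_limit _ (gram_limitD
  (gram_limitM (gtD i) (gram_limit_prod r p gD))
  (gram_limitM (gram_limitM (gt i) (gD i)) ih))) => z w.
by rewrite !big_cons pi; ring.
Qed.
End Kernels.

(** * The kernel of the P-triangle *)

Section TriangleKernel.
Variables (R : realType) (n : nat).
Local Notation C := R[i].
Implicit Types (p : mpoly n C) (z w : 'rV[C]_n).

(** A monomial in the products [x_i conj(y_i)] splits as [x^u conj(y^u)], a rank-one Gram kernel. *)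
Lemma finite_gram_peval (X : Type) (f : X -> 'rV[C]_n) p :
  (forall u, 0 <= mcoeff u p) ->
  finite_gram (fun x y => peval p (diamond (f x) (conjv (f y)))).
Proof.
move=> p0.
have -> : (fun x y => peval p (diamond (f x) (conjv (f y)))) = fun x y =>
    \sum_(u <- msupp p) mcoeff u p *
      ((\prod_i f x 0 i ^+ u i) * (\prod_i f y 0 i ^+ u i)^*).
  apply/funext => x; apply/funext => y; rewrite /peval mevalE.
  apply: eq_bigr => u _; congr *%R; rewrite rmorph_prod -big_split/=.
  by apply: eq_bigr => i _; rewrite !mxE exprMn rmorphXn.
apply: finite_gram_sum => u; apply: finite_gramM.
  exact: finite_gramC.
exact: (finite_gram1 (fun x => \prod_i f x 0 i ^+ u i)).
Qed.

Lemma peval0 p : peval p 0 = mcoeff (@mnm0 n) p.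
Proof.
rewrite /peval mevalE.
have v0 (u : multinom n) :
    \prod_(i < n) ((0 : 'rV[C]_n) 0 i) ^+ u i = (u == (@mnm0 n))%:R.
  have [->|uN0] := eqVneq; first by rewrite big1// => i _; rewrite mnm0E.
  have [i ui] : exists i, u i != 0%N.
    apply/existsP; apply: contra_neqT uN0; rewrite negb_exists => /forallP u0.
    by apply/mnmP => i; rewrite mnm0E; apply/eqP; have := u0 i; rewrite negbK.
  by rewrite (bigD1 i)//= mxE expr0n (negbTE ui) mul0r.
under eq_bigr do rewrite v0.
have [p0|p0] := boolP ((@mnm0 n) \in msupp p).
  rewrite (bigD1_seq (@mnm0 n))//= eqxx mulr1 big1 ?addr0// => u /negbTE->.
  by rewrite mulr0.
rewrite (memN_msupp_eq0 p0) big_seq big1// => u up.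
by case: eqVneq up p0 => [->->|_ _ _]; rewrite ?mulr0.
Qed.

(** Links the derivatives in the norm bound to the linear coefficients in which the kernels are
    computed. *)
Lemma peval_mderiv0 p i : peval (mderiv i p) 0 = mcoeff (mnm1 i) p.
Proof. by rewrite peval0 mcoeff_deriv mnm0E add0m mulr1n. Qed.

(* Padding by 1 makes [phi z 0 j = coords z j / coords z j.+1] hold for the last
   index too. *)
Definition coords z (k : nat) : C := if insub k is Some i then z 0 i else 1.

Lemma phiE z (j : 'I_n) : phi z 0 j = coords z j / coords z j.+1.
Proof.
rewrite mxE /coords valK; case: insubP => [k _ _//|_].
by rewrite divr1.
Qed.

Lemma prod_phi z (j : 'I_n) : (forall i : 'I_n, (0 < i)%N -> z 0 i != 0) ->
  \prod_(l < n | (j <= l)%N) phi z 0 l = z 0 j.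
Proof.
move=> z0; under eq_bigr do rewrite phiE.
have := big_geq_mkord j n predT (fun l => coords z l / coords z l.+1).
move=> /= <-.
have cN0 k : (0 < k)%N -> coords z k != 0.
  rewrite /coords; case: insubP => [i _ <-|_ _]; [exact: z0|exact: oner_neq0].
have cj : coords z j = z 0 j by rewrite /coords valK.
have cn : coords z n = 1 by rewrite /coords; case: insubP => //= i; rewrite ltnn.
(* Inverses give the quotients the form [f k.+1 / f k]. Nonvanishing is then asked only strictly
   above [j], so the first coordinate may be zero. *)
rewrite (telescope_prodf_eq (fun k => (coords z k)^-1)).
- by rewrite cn invr1 mul1r invrK.
- by move=> k /andP[jk _]; rewrite invr_eq0 cN0// (leq_ltn_trans _ jk).
- exact: ltn_ord.
- by move=> k _; rewrite invrK mulrC.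
Qed.

Variable P : 'I_n -> mpoly n C.
Hypothesis hP : positive_regular P.

(** Forms of degree at least 2 have no monomial of degree 1, so this coefficient is the [a] of
    positive regularity. *)
Lemma linear_coeff_gt0 j : 0 < mcoeff (mnm1 j) (P j).
Proof.
have [_ [a [N [Q [a0 hQ ->]]]]] := hP j.
rewrite mcoeffD mcoeffZ mcoeffX eqxx mulr1 raddf_sum big_nat_cond big1 ?addr0//=.
move=> k /andP[/andP[k2 _] _]; apply: (dhomog_nemf_coeff (hQ k)).
by rewrite /= mdeg1; case: k k2 => [|[]].
Qed.

Let ukernel j (x y : triangle P) : C :=
  phi (val x) 0 j * (phi (val y) 0 j)^*.
Let pkernel j (x y : triangle P) : C :=
  peval (P j) (diamond (phi (val x)) (conjv (phi (val y)))).

Let pkernel_lt1 j x : pkernel j x x < 1.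
Proof. by have [_] := set_valP x; exact. Qed.

Let finite_gram_linear j :
  finite_gram (fun x y => mcoeff (mnm1 j) (P j) * ukernel j x y).
Proof.
apply: finite_gramM; first exact/finite_gramC/ltW/linear_coeff_gt0.
exact: (finite_gram1 (fun x : triangle P => phi (val x) 0 j)).
Qed.

(** Removing the linear term cancels the coefficient at [mnm1 j] and leaves all others, which are
    nonnegative. *)
Let finite_gram_higher j :
  finite_gram (fun x y => pkernel j x y - mcoeff (mnm1 j) (P j) * ukernel j x y).
Proof.
have := @finite_gram_peval (triangle P) (fun x => phi (val x))
  (P j - mcoeff (mnm1 j) (P j) *: mpolyX C (mnm1 j)).
case=> [u|s e].
  rewrite mcoeffB mcoeffZ mcoeffX; case: eqP => [<-|_].
    by rewrite mulr1 subrr.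
  by rewrite mulr0 subr0; case: (hP j) => + _; exact.
exists s => x y; rewrite -e /peval mevalB mevalZ mevalXU.
by rewrite /pkernel /ukernel !mxE.
Qed.

Lemma gram_limit_shifted_kernel (m : 'I_n -> nat) (j : 'I_n) :
  (forall l, (0 < m l)%N) ->
  gram_limit (fun x y : triangle P =>
    (1 / (\prod_(l < n | (j <= l)%N) mcoeff (mnm1 l) (P l)) -
      val x 0 j * (val y 0 j)^*) * triangle_kernel m x y).
Proof.
move=> m0; set c := \prod_(l < n | _) _.
have c0 : 0 < c by apply: prodr_gt0 => l _; exact: linear_coeff_gt0.
pose D l x y := (1 / (1 - pkernel l x y)) ^+ m l.
have gp l : finite_gram (pkernel l).
  by apply: finite_gram_peval => u; case: (hP l) => + _; exact.
have gD l : gram_limit (D l).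
  by apply/gram_limitX/gram_limit_inv1B => // x; exact: pkernel_lt1.
have gt l := finite_gram_limit (finite_gram_linear l).
have g1 : gram_limit (fun x y : triangle P =>
    \prod_(l < n | (0 < l)%N) (1 / (val x 0 l * (val y 0 l)^*))).
  apply: gram_limit_prod => l; apply: finite_gram_limit.
  have [s e] := finite_gram1 (fun x : triangle P => (val x 0 l)^-1).
  by exists s => x y; rewrite -e fmorphV mul1r invfM.
have g2 := gram_limit_1B_prod (index_enum _) (fun l : 'I_n => (j <= l)%N) gt gD
  (fun l => gram_limit_1BM_inv1BX (finite_gram_linear l) (finite_gram_higher l)
              (pkernel_lt1 l) (m0 l)).
have g3 := gram_limit_prod (index_enum _) (fun l : 'I_n => ~~ (j <= l)%N) gD.
have gc : @gram_limit R (triangle P) (fun _ _ => c^-1).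
  by apply/finite_gram_limit/finite_gramC; rewrite invr_ge0 ltW.
(* The factors are [1/c], the product of the [1 / (z_l conj(w_l))], the telescoped part over
   [l >= j], and the remaining powers over [l < j]. *)
apply: (eq_gram_limit _ (gram_limitM gc (gram_limitM g1 (gram_limitM g2 g3)))).
move=> x y /=.
have tE : \prod_(l < n | (j <= l)%N) (mcoeff (mnm1 l) (P l) * ukernel l x y) =
    c * (val x 0 j * (val y 0 j)^*).
  rewrite big_split/= big_split/= -rmorph_prod/= !prod_phi//.
    by have [] := set_valP y.
  by have [] := set_valP x.
rewrite tE /triangle_kernel.
rewrite [X in _ = _ * (_ * X)](bigID (fun l : 'I_n => (j <= l)%N))/=.
have DE l : 1 / (1 - peval (P l) (diamond (phi (val x)) (conjv (phi (val y)))))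
    ^+ m l = D l x y by rewrite /D /pkernel expr_div_n expr1n.
rewrite (eq_bigr _ (fun l _ => DE l)).
rewrite [X in _ = _ * (_ * (_ * X))](eq_bigr _ (fun l _ => DE l)).
have cN0 := lt0r_neq0 c0.
by rewrite div1r; field.
Qed.
End TriangleKernel.

(** * Adjoints and multipliers *)

(** A discriminant bound, with [A + 1] for [A] to cover [A = 0]. It yields both a Cauchy-Schwarz
    inequality and the approximate first-order condition at a near-minimizer. *)
Lemma quadratic_ge0_le (K : numClosedFieldType) (e A d : K) : 0 <= A ->
  (forall l : K, 0 <= e + `|l| ^+ 2 * A + (l * d + (l * d)^*)) ->
  `|d| ^+ 2 <= (A + 1) * e.
Proof.
move=> A0 h.
have A1 : 0 < A + 1 by rewrite ltr_wpDl.
have A1V : (A + 1)^-1 ^* = (A + 1)^-1.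
  by rewrite conj_Creal// realV gtr0_real.
(* Almost the minimizer [- d^* / A], but also defined for [A = 0]. *)
have := h (- (A + 1)^-1 * d^*).
have -> : - (A + 1)^-1 * d^* * d = - ((A + 1)^-1 * `|d| ^+ 2).
  by rewrite normCK; ring.
rewrite rmorphN rmorphM/= A1V.
have -> : (`|d| ^+ 2)^* = `|d| ^+ 2 by rewrite conj_Creal// realX.
rewrite normrM normrN norm_conjC [`|_^-1|]ger0_norm ?invr_ge0 ?(ltW A1)//.
move=> h1; have : 0 <= (A + 1) * e - (2 - A / (A + 1)) * `|d| ^+ 2.
  rewrite -(pmulr_rge0 _ A1) in h1.
  suff -> : (A + 1) * e - (2 - A / (A + 1)) * `|d| ^+ 2 = (A + 1) *
   (e + ((A + 1)^-1 * `|d|) ^+ 2 * A +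
    (- ((A + 1)^-1 * `|d| ^+ 2) - (A + 1)^-1 * `|d| ^+ 2)) by [].
  by have := lt0r_neq0 A1; move: (`|d|) => x A1N; field.
(* The coefficient [2 - A / (A + 1)] is at least 1. *)
rewrite subr_ge0; apply: le_trans.
rewrite ler_peMl ?exprn_ge0// lerBrDr -[2]/(1 + 1) lerD2l.
by rewrite ler_pdivrMr// mul1r lerDl.
Qed.

Section Hilbert.
Variables (R : realType).
Local Notation C := R[i].
Variables (V : completeNormedModType C) (dot : {dot V for Num.conj}).
Hypothesis dotE : forall f : V, `|f| ^+ 2 = dot f f.

Let dotC u v : dot u v = (dot v u)^*.
Proof. by rewrite (hermC dot) mul1r. Qed.

Let dotZD (l : C) u v : dot (l *: u + v) (l *: u + v) =
  dot v v + `|l| ^+ 2 * dot u u + (l * dot u v + (l * dot u v)^*).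
Proof. by rewrite dnormD dnormZ linearZl_LR/=; ring. Qed.

(* A weak form of Cauchy-Schwarz, which suffices for continuity in [v]. *)
Lemma dot_normsq_le u v : `|dot u v| ^+ 2 <= (dot u u + 1) * dot v v.
Proof.
apply: quadratic_ge0_le; first exact: dnorm_ge0.
by move=> l; rewrite -dotZD dnorm_ge0.
Qed.

(* [g] is the limit of the first components of a sequence in [G] minimizing
   [J p = |p.1|^2 - 2 Re <p.2, f>], as in the proof of the Riesz representation
   theorem; [G] need not be closed or single-valued. *)
Lemma bounded_graph_adjoint (G : set (V * V)) (c : C) (f : V) :
  0 < c -> G 0 -> (forall (l : C) p q, G p -> G q -> G (l *: p + q)) ->
  (forall p, G p -> `|p.2| <= c * `|p.1|) ->
  exists2 g, `|g| <= c * `|f| & forall p, G p -> dot p.1 g = dot p.2 f.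
Proof.
move=> c0 G0 Glin Gc.
pose J (p : V * V) := dot p.1 p.1 - (dot p.2 f + (dot p.2 f)^*).
(* Expansion of [J] around [q] in the direction [p]; the coefficient of [l] measures the failure of
   the adjoint relation at [q.1]. *)
have JZD l p q : J (l *: p + q) = J q + `|l| ^+ 2 * dot p.1 p.1 +
    (l * (dot p.1 q.1 - dot p.2 f) + (l * (dot p.1 q.1 - dot p.2 f))^*).
  rewrite /J/= dotZD linearDl linearZl_LR/= mulrBr !rmorphB !rmorphD/=.
  by ring.
(* The infimum is taken in [R], while [J] has values in [R[i]]. *)
have reJ p : (complex.Re (J p))%:C%C = J p.
  rewrite RRe_real// rpredB//; first by rewrite ger0_real ?dnorm_ge0.
  apply/CrealP.
  by rewrite rmorphD/= conjCK addrC.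
have cN0 : c != 0 := lt0r_neq0 c0.
have cR : c^* = c by rewrite conj_Creal// gtr0_real.
(* The weights [c^-1] and [c] make [|p.2|] comparable to [|p.1|]. This bounds [J] from below and
   later gives the sharp bound on [g]. *)
have Cf p : G p -> dot p.2 f + (dot p.2 f)^* <= dot p.1 p.1 + c ^+ 2 * dot f f.
  move=> Gp; have : 0 <= dot (c^-1 *: p.2 - c *: f) (c^-1 *: p.2 - c *: f).
    exact: dnorm_ge0.
  rewrite dnormB !dnormZ linearZl_LR linearZr_LR/= cR mulrA mulVf// mul1r.
  rewrite subr_ge0 => /le_trans; apply.
  rewrite [`|c|]ger0_norm ?(ltW c0)// lerD2r.
  rewrite -!dotE -exprMn -normrZ lerXn2r ?nnegrE//.
  rewrite normrZ normfV [`|c|]ger0_norm ?(ltW c0)//.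
  by rewrite ler_pdivrMl//; exact: Gc.
pose E := [set complex.Re (J p) | p in G].
have Elb : has_inf E.
  split; first by exists (complex.Re (J 0)), 0.
  exists (- complex.Re (c ^+ 2 * dot f f)) => _ [p Gp <-].
  have cfR : ((complex.Re (c ^+ 2 * dot f f))%:C)%C = c ^+ 2 * dot f f.
    by rewrite RRe_real// ger0_real// mulr_ge0 ?exprn_ge0 ?(ltW c0) ?dnorm_ge0.
  rewrite -lecR rmorphN/= reJ cfR lerBrDr addrC lerBlDr.
  exact: Cf.
have J_ge p : G p -> ((inf E)%:C)%C <= J p.
  by move=> Gp; rewrite -reJ lecR; apply: ge_inf; [exact: Elb.2|exists p].
have near_min e : 0 < e -> exists2 p, G p & J p < ((inf E)%:C)%C + e.
  move=> e0; have /complex_realP[d ed] := gtr0_real e0.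
  have d0 : 0 < d by rewrite -ltcR -ed.
  have [_ [p Gp <-] hp] := inf_adherent d0 Elb.
  by exists p => //; rewrite -reJ ed -rmorphD ltcR.
(* The parallelogram law: compare with [J] at the midpoint of [p] and [q]. *)
have dist p q e d : G p -> G q -> J p < ((inf E)%:C)%C + e ->
    J q < ((inf E)%:C)%C + d -> `|p.1 - q.1| ^+ 2 <= 2 * (e + d).
  move=> Gp Gq Jp Jq; pose r := (-1) *: q + p.
  have Gr : G r by exact: Glin.
  have Gm : G (2^-1 *: r + q) by exact: Glin.
  have := J_ge _ Gm.
  have pE : p = 1 *: r + q by rewrite scale1r /r scaleN1r addrAC addNr add0r.
  have rE : r.1 = p.1 - q.1 by rewrite /r/= scaleN1r addrC.
  move: Jp; rewrite {1}pE !JZD -rE dotE normr1 ger0_norm ?invr_ge0 ?ler0n//.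
  have hV : (2^-1)^* = 2^-1 :> C by rewrite fmorphV rmorph_nat.
  rewrite !mul1r expr1n mul1r rmorphM/= hV -mulrDr.
  set B := dot r.1 q.1 - dot r.2 f + _; set A := dot r.1 r.1.
  set I := ((inf E)%:C)%C in Jq *.
  move=> h1 h2; rewrite -subr_ge0.
  (* The slacks at [p], at [q] and at the midpoint appear with weights 2, 2 and 4; each is
     nonnegative. *)
  have -> : 2 * (e + d) - A = 2 * (I + e - (J q + A + B)) + 2 * (I + d - J q) +
      4 * (J q + 2^-1 ^+ 2 * A + 2^-1 * B - I) by field.
  apply: addr_ge0; [apply: addr_ge0|]; apply: mulr_ge0;
    rewrite ?ler0n// subr_ge0//.
    exact: ltW h1.
  exact: ltW Jq.
have /choice[a ha] : forall n : nat,
    exists p, G p /\ J p < ((inf E)%:C)%C + n.+1%:R^-1.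
  move=> n.
  by have [|p Gp Jp] := near_min n.+1%:R^-1; [rewrite invr_gt0|exists p].
have inv_lt e : 0 < e -> exists N : nat, N.+1%:R^-1 < e :> C.
  move=> e0; have /complex_realP[d ed] := gtr0_real e0.
  have d0 : 0 < d by rewrite -ltcR -ed.
  exists (Num.bound d^-1).
  rewrite ed -[_%:R](rmorph_nat (real_complex R)) -fmorphV ltcR.
  rewrite invf_plt ?posrE// (lt_trans (archi_boundP _))// ?invr_ge0 ?(ltW d0)//.
  by rewrite ltr_nat.
have a_cauchy : cauchy ((a n).1 @[n --> \oo]).
  apply: cauchy_exP => e e0.
  (* Beyond [N], [dist] bounds squared distances to [(a N).1] by [4 / (N + 1)]. *)
  have [|N hN] := inv_lt (e ^+ 2 / 4); first by rewrite divr_gt0 ?exprn_gt0.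
  exists (a N).1; suff : \forall n \near \oo, ball (a N).1 e (a n).1 by [].
  near=> n.
  rewrite -ball_normE/=.
  rewrite -(@ltr_pXn2r _ 2)// ?nnegrE ?(ltW e0)//.
  apply: (le_lt_trans (dist _ _ _ _ (ha N).1 (ha n).1 (ha N).2 (ha n).2)).
  apply: (@le_lt_trans _ _ (4 * N.+1%:R^-1)); last first.
    by rewrite -ltr_pdivlMl// mulrC.
  have -> : 4 = 2 * 2 :> C by rewrite -natrM.
  rewrite -mulrA ler_pM2l// mulr_natl mulr2n lerD2l.
  by rewrite lef_pV2 ?posrE// ler_nat ltnS; near: n; exact: nbhs_infty_ge.
have /cauchy_cvgP/cvg_ex[g ag] := a_cauchy.
have g_near e : 0 < e ->
    exists p, [/\ G p, `|g - p.1| ^+ 2 < e & J p < ((inf E)%:C)%C + e].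
  move=> e0; have [N hN] := inv_lt e e0.
  have se0 : 0 < sqrtC e by rewrite sqrtC_gt0.
  have /cvgrPdist_lt/(_ _ se0) ag' := ag.
  have [n [hn hNn]] := filter_ex (filterI ag' (nbhs_infty_ge N)).
  exists (a n); split; first exact: (ha n).1.
    by rewrite -[X in _ < X]sqrtCK; apply: (ltrXn2r _ _ hn) => //;
       exact: normr_ge0.
  apply: (lt_le_trans (ha n).2); rewrite lerD2l; apply: le_trans (ltW hN).
  by rewrite lef_pV2 ?posrE// ler_nat ltnS.
have g_adj p : G p -> dot p.1 g = dot p.2 f.
  move=> Gp; apply/eqP; rewrite -subr_eq0; apply/negPn/negP => D0.
  set D := _ - _ in D0; set A1 := dot p.1 p.1 + 1.
  have A10 : 0 < A1 by rewrite ltr_wpDl// dnorm_ge0.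
  have D2 : 0 < `|D| ^+ 2 by rewrite exprn_gt0// normr_gt0.
  (* [D] is a sum of two terms of squared modulus at most [A1 * e], so [|D|^2 <= 4 * A1 * e]; the 8
     makes this [|D|^2 / 2], a contradiction. *)
  have [|q [Gq gq Jq]] := g_near (`|D| ^+ 2 / (8 * A1)).
    by rewrite divr_gt0// mulr_gt0.
  set e := _ / (8 * A1) in gq Jq.
  have x2 : `|dot p.1 (g - q.1)| ^+ 2 <= A1 * e.
    apply: (le_trans (dot_normsq_le _ _)).
    by rewrite ler_pM2l// -dotE ltW.
  (* For every [l], [J (l *: p + q)] is at least the infimum, hence exceeds [J q - e]. *)
  have y2 : `|dot p.1 q.1 - dot p.2 f| ^+ 2 <= A1 * e.
    apply: quadratic_ge0_le; first exact: dnorm_ge0.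
    move=> l; have := J_ge _ (Glin l _ _ Gp Gq).
    rewrite JZD -subr_ge0 => /le_trans; apply.
    rewrite lerBlDl !addrA !lerD2r ltW//.
  have DE : D = dot p.1 (g - q.1) + (dot p.1 q.1 - dot p.2 f).
    by rewrite linearBr addrA subrK.
  have : `|D| ^+ 2 <= 4 * (A1 * e).
    have D_le : `|D| <= 2 * sqrtC (A1 * e).
      rewrite DE (le_trans (ler_normD _ _))// mulr_natl mulr2n.
      have s0 : 0 <= A1 * e by apply: le_trans y2; exact: exprn_ge0.
      by rewrite lerD// -(@ler_pXn2r _ 2)// ?nnegrE ?sqrtC_ge0// sqrtCK.
    have -> : 4 * (A1 * e) = (2 * sqrtC (A1 * e)) ^+ 2.
      by rewrite exprMn sqrtCK -natrX.
    by rewrite lerXn2r// nnegrE (le_trans _ D_le).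
  have -> : 4 * (A1 * e) = `|D| ^+ 2 / 2.
    by rewrite /e; field; exact: lt0r_neq0.
  by rewrite ler_pdivlMr// ger_pMr// -[X in _ <= X](addr0 1) lerD2l ler10.
exists g => //.
rewrite -(@ler_pXn2r _ 2)// ?nnegrE ?mulr_ge0 ?(ltW c0)//.
rewrite exprMn !dotE; apply/ler_addgt0Pr => e e0.
have [q [Gq gq _]] := g_near e e0.
rewrite addrC -lerBlDr; apply: le_trans (ltW gq).
(* By adjointness [|g - q.1|^2 = |g|^2 + |q.1|^2 - 2 Re <q.2, f>], which [Cf] bounds below by
   [|g|^2 - c^2 |f|^2]. *)
rewrite dotE dnormB (dotC g q.1) g_adj// conjCK -addrA lerD2l lerBrDr addrC.
by rewrite lerBlDr addrC; exact: Cf.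
Unshelve. all: by end_near.
Qed.
End Hilbert.

(** [G] relates combinations of kernel functions to their images under [k_x |-> conj(h x) k_x]; as a
    relation it tolerates linear dependence among the [k_x]. Testing the adjoint relation on [k_x]
    gives [g x = h x * f x]. *)
Lemma rkhs_multiplier (R : realType) (X : Type) (K : X -> X -> R[i])
    (H : rkhs K) (h : X -> R[i]) (c : R[i]) : 0 < c ->
  gram_limit (fun x y => (c ^+ 2 - h x * (h y)^*) * K x y) ->
  forall f : H, exists2 g : H, `|g| <= c * `|f| &
    forall x, rkhs_fun H g x = h x * rkhs_fun H f x.
Proof.
move=> c0 hK f; pose dot := rkhs_dot H.
have dotC (u v : H) : dot u v = (dot v u)^* by rewrite (hermC dot) mul1r.
have dot_ker x y : dot (rkhs_ker H x) (rkhs_ker H y) = K y x.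
  by rewrite -rkhs_reproducing rkhs_kerE.
pose comb (a : R[i] * X -> R[i]) s := \sum_(t <- s) a t *: rkhs_ker H t.2.
have comb_lin a l s t : (forall u, a (l * u.1, u.2) = l * a u) ->
    comb a ([seq (l * u.1, u.2) | u <- s] ++ t) = l *: comb a s + comb a t.
  move=> al; rewrite /comb big_cat big_map scaler_sumr; congr (_ + _).
  by apply: eq_bigr => u _; rewrite al scalerA.
have dot_comb a s : dot (comb a s) (comb a s) =
    \sum_(t <- s) \sum_(u <- s) a t * (a u)^* * K u.2 t.2.
  rewrite linear_sumlz; apply: eq_bigr => t _.
  rewrite linear_sumr; apply: eq_bigr => u _.
  by rewrite linearZl_LR linearZr_LR/= dot_ker mulrA.
pose hc (t : R[i] * X) := t.1 * (h t.2)^*.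
pose G := [set (comb fst s, comb hc s) | s in [set: seq (R[i] * X)]].
have [|||g gf gG] :=
  @bounded_graph_adjoint R H dot (@rkhs_normE _ _ _ H) G c f c0.
- by exists [::] => //; rewrite /comb !big_nil.
- move=> l _ _ [s _ <-] [t _ <-].
  exists ([seq (l * u.1, u.2) | u <- s] ++ t) => //.
  by rewrite !comb_lin// => u; rewrite /hc mulrA.
- move=> _ [s _ <-] /=.
  rewrite -(@ler_pXn2r _ 2)// ?nnegrE ?mulr_ge0 ?(ltW c0)//.
  rewrite exprMn !rkhs_normE !dot_comb -subr_ge0.
  have := gram_limit_psd s hK; congr (0 <= _).
  rewrite mulr_sumr -sumrB; apply: eq_bigr => t _.
  rewrite mulr_sumr -sumrB; apply: eq_bigr => u _.
  by rewrite /hc rmorphM/= conjCK; ring.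
exists g => // x.
have Gx : G (rkhs_ker H x, (h x)^* *: rkhs_ker H x).
  exists [:: (1, x)] => //; rewrite /comb !big_seq1/= scale1r.
  by rewrite /hc mul1r.
have /= := gG _ Gx; rewrite linearZl_LR/= dotC => gx.
rewrite !rkhs_reproducing -[rkhs_dot H g _]conjCK gx rmorphM/= conjCK.
by rewrite -dotC.
Qed.

(** * Multiplication by the coordinates on the P-triangle *)

Theorem proposition4p2 (R : realType) (n : nat) (hn : (2 <= n)%N)
    (P : 'I_n -> mpoly n R[i]) (hP : positive_regular P)
    (m : 'I_n -> nat) (hm : forall j, (0 < m j)%N)
    (H : hardy_triangle P m) :
  exists M : 'I_n -> {linear H -> H},
    [/\ forall j (f g : H), M j f = g <-> mulz_graph j f g,
        forall j, bounded_operator (M j),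
        forall i j (f : H), M i (M j f) = M j (M i f) &
        forall j, ((opnorm (M j))%:C)%C <=
          1 / sqrtC (\prod_(l < n | (j <= l)%N) peval (mderiv l (P l)) 0)].
Proof.
pose b (j : 'I_n) := \prod_(l < n | (j <= l)%N) peval (mderiv l (P l)) 0.
pose c j := 1 / sqrtC (b j).
have b0 j : 0 < b j.
  by apply: prodr_gt0 => l _; rewrite peval_mderiv0; exact: linear_coeff_gt0.
have c0 j : 0 < c j by rewrite divr_gt0// sqrtC_gt0.
have ex_mul j (f : H) : exists g : H, `|g| <= c j * `|f| /\ mulz_graph j f g.
  have [|g gf gE] :=
    rkhs_multiplier (h := fun x : triangle P => val x 0 j) (c0 j) _ f.
    apply: eq_gram_limit (gram_limit_shifted_kernel hP j hm) => x y.
    congr ((_ - _) * _); rewrite /c expr_div_n expr1n sqrtCK /b.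
    by under [in RHS]eq_bigr do rewrite peval_mderiv0.
  by exists g.
have graph_inj j (f g1 g2 : H) : mulz_graph j f g1 ->
    mulz_graph j f g2 -> g1 = g2.
  by move=> e1 e2; apply: rkhs_fun_inj; apply/funext => z; rewrite e1 e2.
have /choice[T hT] : forall j, exists T : H -> H, forall f,
    `|T f| <= c j * `|f| /\ mulz_graph j f (T f).
  by move=> j; have /choice[T hT] := ex_mul j; exists T.
(* Linearity comes from uniqueness: both sides have the same values as functions. *)
have T_linear j : linear (T j).
  move=> a f g; apply: (graph_inj j _ _ _ (hT j _).2) => z.
  by rewrite !linearP !fctE (hT j f).2 (hT j g).2/= mulrDr mulrCA.
pose M j : {linear H -> H} :=
  HB.pack (T j) (GRing.isLinear.Build _ _ _ _ (T j) (T_linear j)).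
have Mle j f : `|M j f| <= c j * `|f| by exact: (hT j f).1.
have Mgraph j f : mulz_graph j f (M j f) by exact: (hT j f).2.
have cR j : c j = ((complex.Re (c j))%:C)%C by rewrite RRe_real// gtr0_real.
exists M; split.
- by move=> j f g; split=> [<-//|]; exact/graph_inj.
- by move=> j; exists (complex.Re (c j)) => f; rewrite -cR.
- move=> i j f; apply: rkhs_fun_inj; apply/funext => z.
  by rewrite !Mgraph mulrCA.
(* Bounding the supremum requires a nonempty set; the zero vector lies in the unit ball. *)
- move=> j; rewrite -/(c j) cR lecR; apply: ge_sup.
    by exists (complex.Re `|M j 0|), 0 => //=; rewrite normr0.
  move=> _ [f /= f1 <-]; rewrite -lecR -cR RRe_real ?normr_real//.
  by rewrite (le_trans (Mle j f))// ler_piMr// ltW.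
Qed.
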